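(* Assume $r>0$. For $n\ge0$ and $m\ge1$ define $$x^{[m]*}_n:=\sup\{x\in(0,K]:g(x)\ge f^{[m]}_n(x)\},\qquad D^{[m]}_n:=\{x\in(0,K]:g(x)\ge f^{[m]}_n(x)\}.$$ Then: (i) The map $x\mapsto g(x)-f^{[m]}_n(x)$ is nonincreasing on $(0,K]$, is positive near $0$ and nonpositive at $K$; consequently $x^{[m]*}_n\in(0,K]$ and $D^{[m]}_n=(0,x^{[m]*}_n]$. Exercise is an optimal action on $D^{[m]}_n$ (i.e. for $n\ge1$ the first term attains the maximum in the recursion defining $V^{[m]}_n(x)$), and for $x>K$ continuation is an optimal action (the second term attains the maximum when $n\ge1$), being merely a tie-breaking choice when $g(x)=f^{[m]}_n(x)=0$. (ii) $0<x^{[m]*}_N\le x^{[m]*}_{N-1}\le\dots\le x^{[m]*}_1\le x^{[m]*}_0=K$, and $x^{[m]*}_n=K$ for all $n\le m-1$. (iii) $x^{[1]*}_n\le x^{[2]*}_n\le\dots\le x^{[m]*}_n$ for every $n$, hence $D^{[1]}_n\subseteq D^{[2]}_n\subseteq\dots\subseteq D^{[m]}_n$. (iv) Define recursively, with $\min\emptyset:=\partial$, $$\sigma^*_m=\min\{\nu\in\{0,\dots,N\}:S_\nu\in D^{[m]}_{N-\nu}\},$$ $$\sigma^*_i=\min\{\nu\in\{0,\dots,N\}:\nu>\sigma^*_{i+1},\ S_\nu\in D^{[i]}_{N-\nu}\},\quad i=m-1,\dots,1.$$ The finite entries of $(\sigma^*_m,\dots,\sigma^*_1)$ are strictly increasing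 and all unused rights are placed at $\partial$. This policy is optimal, and $$V^{[m]}_N(S_0)=\mathrm E\Big[\sum_{i:\,\sigma^*_i\le N}\alpha^{\sigma^*_i}(K-S_{\sigma^*_i})^+\Big]=\sup_{\vec\tau\in\mathcal T^{[m]}_0}\mathrm E\Big[\sum_{i:\,\tau_i\le N}\alpha^{\tau_i}(K-S_{\tau_i})^+\Big].$$
   Context: Let $r\ge0$, $\alpha:=(1+r)^{-1}$, and $\lambda>1$ with $\lambda^{-1}<1+r<\lambda$. Put $p:=\frac{(1+r)-\lambda^{-1}}{\lambda-\lambda^{-1}}$, $q:=1-p$ (both in $(0,1)$). Let $N$ be a finite horizon, $S_0>0$ a constant and $S_\nu=S_0\lambda^{\varepsilon_1+\dots+\varepsilon_\nu}$ ($0\le\nu\le N$), where under $\mathrm P$ the $\varepsilon_\nu$ are i.i.d. with $\mathrm P(\varepsilon_\nu=1)=p$, $\mathrm P(\varepsilon_\nu=-1)=q$; $(\mathcal F_\nu)_{\nu=0}^N$ is the natural filtration of $S$. Let $K>0$ and $g(x):=(K-x)^+$ for $x>0$. For a function $\varphi$ on $(0,\infty)$ let $(\mathcal A\varphi)(x):=\alpha[p\,\varphi(\lambda x)+q\,\varphi(\lambda^{-1}x)]$. Define functions on $(0,\infty)$ recursively by $V^{[0]}_n\equiv0$ ($n\ge0$), $V^{[m]}_0=g$ ($m\ge1$), and, for $n,m\ge1$, $$V^{[m]}_n(x)=\max\{g(x)+(\mathcal AV^{[m-1]}_{n-1})(x),\ (\mathcal AV^{[m]}_{n-1})(x)\},$$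 where the first term corresponds to exercising one right and the second to continuing. For $m\ge1$ put $\Delta V^{[m]}_n:=V^{[m]}_n-V^{[m-1]}_n$ ($n\ge 0$), $f^{[m]}_n:=\mathcal A\,\Delta V^{[m]}_{n-1}$ ($n\ge1$) and $f^{[m]}_0:=0$. Admissible exercise vectors: let $\partial:=+\infty$ denote non-exercise. $\mathcal T^{[m]}_0$ is the set of vectors $(\tau_m,\tau_{m-1},\dots,\tau_1)$ of $(\mathcal F_\nu)$-stopping times with values in $\{0,\dots,N\}\cup\{\partial\}$ such that, pathwise, for some $\ell\in\{0,\dots,m\}$ (possibly depending on $\omega$) the finite coordinates are exactly $\tau_m,\dots,\tau_{m-\ell+1}$, with $0\le\tau_m<\tau_{m-1}<\dots<\tau_{m-\ell+1}\le N$, and the remaining coordinates equal $\partial$. *)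

(* Defs.v *)
From HB Require Import structures.
From mathcomp Require Import all_boot all_order all_algebra finmap.
From mathcomp Require Import all_classical all_reals all_analysis.

Set Implicit Arguments.
Unset Strict Implicit.
Unset Printing Implicit Defensive.

Import Order.TTheory GRing.Theory Num.Theory numFieldNormedType.Exports.

Local Open Scope classical_set_scope.
Local Open Scope ring_scope.

Section value_functions.
Context {R : realType}.
Implicit Types (r lam K x : R) (phi : R -> R).

Definition discount r : R := (1 + r)^-1.

Definition up_prob r lam : R := (1 + r - lam^-1) / (lam - lam^-1).

Definition put K x : R := Num.max (K - x) 0.

Definition one_step r lam phi x : R :=
  discount r * (up_prob r lam * phi (lam * x)
                + (1 - up_prob r lam) * phi (lam^-1 * x)).

(* [swing_value r lam K m n] is V^[m]_n: m rights left, n periods to go.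
   All functions of this section are only meaningful for x > 0. *)
Fixpoint swing_value r lam K (m n : nat) (x : R) {struct n} : R :=
  match m, n with
  | 0%N, _ => 0
  | _.+1, 0%N => put K x
  | m'.+1, n'.+1 =>
      Num.max (put K x + one_step r lam (swing_value r lam K m' n') x)
              (one_step r lam (swing_value r lam K m n') x)
  end.

(* Only used for m >= 1, where [m.-1] is the true predecessor. *)
Definition marginal_value r lam K (m n : nat) x : R :=
  swing_value r lam K m n x - swing_value r lam K m.-1 n x.

Definition continuation r lam K (m n : nat) x : R :=
  if n is n'.+1 then one_step r lam (marginal_value r lam K m n') x else 0.

Definition exercise_region r lam K (m n : nat) : set R :=
  [set x | 0 < x <= K /\ continuation r lam K m n x <= put K x].

Definition exercise_boundary r lam K (m n : nat) : R :=
  sup (exercise_region r lam K m n).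

End value_functions.

Section probability_notions.
Context {d : measure_display} {Omega : measurableType d} {R : realType}.

Definition mutually_independent (P : probability Omega R) (A : set nat)
    (X : nat -> Omega -> R) : Prop :=
  forall (J : {fset nat}) (B : nat -> set R),
    [set` J] `<=` A -> (forall k, measurable (B k)) ->
    P (\bigcap_(k in [set` J]) X k @^-1` B k)
    = (\prod_(k <- J) P (X k @^-1` B k))%E.

Definition price (S0 lam : R) (eps : nat -> Omega -> R) (nu : nat) (w : Omega)
    : R :=
  S0 * lam `^ (\sum_(1 <= k < nu.+1) eps k w).

Definition natural_filtration (S : nat -> Omega -> R) (nu : nat)
    : set (set Omega) :=
  g_sigma_preimage (fun k : 'I_nu.+1 => S k).

(* Exercise times live in {0, ..., N} together with the non-exercise value
   +oo, which is encoded as [None]. *)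
Definition stopping_time (S : nat -> Omega -> R) (N : nat)
    (tau : Omega -> option 'I_N.+1) : Prop :=
  forall nu : nat, (nu <= N)%N ->
    natural_filtration S nu
      [set w | exists2 k : 'I_N.+1, tau w = Some k & (k <= nu)%N].

(* Exercise vectors are listed as (tau_m, tau_(m-1), ..., tau_1): the entry at
   position j : 'I_m is tau_(m-j). *)
Definition exercise_pattern (m N : nat) (t : 'I_m -> option 'I_N.+1) : Prop :=
  (exists2 l : nat, (l <= m)%N & forall j : 'I_m, (t j != None) = (j < l)%N)
  /\ (forall (j j' : 'I_m) (u u' : 'I_N.+1),
        (j < j')%N -> t j = Some u -> t j' = Some u' -> (u < u')%N).

Definition admissible (S : nat -> Omega -> R) (m N : nat)
    : set ('I_m -> Omega -> option 'I_N.+1) :=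
  [set tau | (forall j, stopping_time S (tau j))
             /\ (forall w, exercise_pattern (fun j => tau j w))].

Definition swing_payoff (r K : R) (S : nat -> Omega -> R) (m N : nat)
    (tau : 'I_m -> Omega -> option 'I_N.+1) (w : Omega) : R :=
  \sum_(j < m)
    (if tau j w is Some nu then discount r ^+ nu * put K (S nu w) else 0).

(* [enum 'I_N.+1] is increasing, so this is the minimum of Q, or [None] when Q
   is empty. *)
Definition first_time (N : nat) (Q : pred 'I_N.+1) : option 'I_N.+1 :=
  ohead [seq nu <- enum 'I_N.+1 | Q nu].

Definition strictly_after (N : nat) (t : option 'I_N.+1) (nu : 'I_N.+1) : bool :=
  if t is Some k then (k < nu)%N else false.

(* sigma*_(m-j), by recursion on the position j. *)
Fixpoint threshold_time (r lam K : R) (S : nat -> Omega -> R) (m N : nat)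
    (j : nat) (w : Omega) : option 'I_N.+1 :=
  match j with
  | 0%N =>
      first_time (fun nu : 'I_N.+1 =>
        S nu w \in exercise_region r lam K m (N - nu))
  | j'.+1 =>
      first_time (fun nu : 'I_N.+1 =>
        strictly_after (threshold_time r lam K S m N j' w) nu
        && (S nu w \in exercise_region r lam K (m - j) (N - nu)))
  end.

Definition threshold_policy (r lam K : R) (S : nat -> Omega -> R) (m N : nat)
    : 'I_m -> Omega -> option 'I_N.+1 :=
  fun j => threshold_time r lam K S m N j.

End probability_notions.

Arguments admissible {d Omega R} S m N.
Arguments threshold_time {d Omega R} r lam K S m N j w.
Arguments threshold_policy {d Omega R} r lam K S m N _ _.

(* Main.v *)
Require Import Defs.
From HB Require Import structures.
From mathcomp Require Import all_boot all_order all_algebra finmap.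
From mathcomp Require Import all_classical all_reals all_analysis.
From mathcomp Require Import measurable_realfun.
From mathcomp Require Import ring lra zify.

Set Implicit Arguments.
Unset Strict Implicit.
Unset Printing Implicit Defensive.

Import Order.TTheory GRing.Theory Num.Theory numFieldNormedType.Exports.

Local Open Scope classical_set_scope.
Local Open Scope ring_scope.

(** Write [V m n], [g], [f m n] for the values, the put payoff and the
continuation values. The increments of [V] in [m] satisfy
[Delta 1 = max (f 1) g] and, as soon as [f m.+1 <= f m],
[Delta m.+1 = max (f m.+1) (min g (f m))]; this recursion propagates by
induction on [n] the order of the [f m n] in [m] and [n] as well as the class of
nonnegative nonincreasing functions [h] with [h x + x] nondecreasing, which the
one-step operator preserves because the discounted price is a martingale. The
first three parts follow.

For optimality, an adapted exercise policy only depends almost surely on the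
signs of the price moves, hence is a control on the binary tree; its expected
payoff is computed by backward induction, is at most [V m N S0] when each path
carries at most [m] exercises, and equals it for the threshold rule. *)

(** * The one-step operator *)

Section put_like.
Context {R : realType}.
Implicit Types (f g : R -> R).

(** The last clause says that [f] falls no faster than the put payoff; it yields the monotone
    exercise gain. The last two clauses together make [f] 1-Lipschitz on the positive axis, which is
    what later closes the exercise region at its supremum. *)
Definition put_like f : Prop :=
  [/\ forall x, 0 < x -> 0 <= f x,
      forall x y, 0 < x -> x <= y -> f y <= f x
    & forall x y, 0 < x -> x <= y -> f x + x <= f y + y].

Lemma put_like0 : put_like (fun=> 0).
Proof. by split=> // x y _ xy; rewrite !add0r. Qed.

Lemma put_like_put (K : R) : put_like (put K).
Proof.
by split=> [x _|x y _ xy|x y _ xy]; rewrite /put;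
   rewrite !maxEle; repeat case: ifPn; rewrite -?ltNge; lra.
Qed.

Lemma put_like_max f g :
  put_like f -> put_like g -> put_like (fun x => Num.max (f x) (g x)).
Proof.
move=> [f0 fd fi] [g0 gd gi]; split=> [x x0|x y x0 xy|x y x0 xy].
- by rewrite le_max f0.
- by rewrite ge_max !le_max fd // gd // orbT.
- by rewrite !addr_maxl ge_max !le_max fi // gi // orbT.
Qed.

Lemma put_like_min f g :
  put_like f -> put_like g -> put_like (fun x => Num.min (f x) (g x)).
Proof.
move=> [f0 fd fi] [g0 gd gi]; split=> [x x0|x y x0 xy|x y x0 xy].
- by rewrite le_min f0 ?g0.
- by rewrite le_min !ge_min fd // gd // orbT.
- by rewrite !addr_minl le_min !ge_min fi // gi // orbT.
Qed.

Lemma put_like_eq (h1 h2 : R -> R) :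
  put_like h1 -> (forall x, 0 < x -> h1 x = h2 x) -> put_like h2.
Proof.
move=> [h0 hd hi] h12; split=> [x x0|x y x0 xy|x y x0 xy].
- by rewrite -h12 ?h0.
- by rewrite -!h12 ?hd// (lt_le_trans x0).
- by rewrite -!h12 ?hi// (lt_le_trans x0).
Qed.

End put_like.

Section one_step_operator.
Context {R : realType} (r lam : R).
Context (r_gt0 : 0 < r) (lam_gt1 : 1 < lam)
  (no_arbitrage : lam^-1 < 1 + r < lam).
Implicit Types (f g : R -> R) (x : R).

Let lam_gt0 : 0 < lam. Proof. exact: lt_trans lam_gt1. Qed.
Let lamV_gt0 : 0 < lam^-1. Proof. by rewrite invr_gt0. Qed.

Lemma discount_gt0 : 0 < discount r.
Proof. by have r0 := r_gt0; rewrite invr_gt0; lra. Qed.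

Lemma discount_lt1 : discount r < 1.
Proof. by have r0 := r_gt0; rewrite invf_lt1; lra. Qed.

Lemma up_prob_gt0 : 0 < up_prob r lam.
Proof. by have /andP[h1 h2] := no_arbitrage; rewrite divr_gt0; lra. Qed.

Lemma up_prob_lt1 : up_prob r lam < 1.
Proof.
by have /andP[h1 h2] := no_arbitrage; rewrite ltr_pdivrMr ?mul1r; lra.
Qed.

Lemma one_step_ge0 f x : 0 < x -> (forall y, 0 < y -> 0 <= f y) ->
  0 <= one_step r lam f x.
Proof.
move=> x0 f0; have := discount_gt0; have := up_prob_gt0.
have := up_prob_lt1 => p1 p0 a0.
by rewrite mulr_ge0 ?(ltW a0)// addr_ge0// mulr_ge0 ?f0 ?mulr_gt0//; lra.
Qed.

Lemma one_stepB f g x :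
  one_step r lam (fun y => f y - g y) x = one_step r lam f x - one_step r lam g x.
Proof. by rewrite /one_step; ring. Qed.

Lemma one_step_cst c x : one_step r lam (fun=> c) x = discount r * c.
Proof. by rewrite /one_step; ring. Qed.

(* [up_prob] is the risk-neutral probability: the discounted price is a
   martingale. *)
Lemma one_step_id x : one_step r lam id x = x.
Proof.
have /andP[h1 h2] := no_arbitrage; have r0 := r_gt0; have l_gt1 := lam_gt1.
rewrite /one_step /discount /up_prob; field.
have l1 : 0 < lam * lam - 1 by rewrite subr_gt0 mulr_egt1.
by rewrite !gt_eqF //; lra.
Qed.

Lemma one_step_eq f g x : 0 < x -> (forall y, 0 < y -> f y = g y) ->
  one_step r lam f x = one_step r lam g x.
Proof. by move=> x0 fg; rewrite /one_step !fg ?mulr_gt0. Qed.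

Lemma one_step_le f g x : 0 < x -> (forall y, 0 < y -> f y <= g y) ->
  one_step r lam f x <= one_step r lam g x.
Proof.
move=> x0 fg; rewrite -subr_ge0 -one_stepB; apply: one_step_ge0 => // y y0.
by rewrite subr_ge0 fg.
Qed.

Lemma put_like_one_step f : put_like f -> put_like (one_step r lam f).
Proof.
move=> [f0 fd fi]; split=> [x x0|x y x0 xy|x y x0 xy].
- exact: one_step_ge0.
- rewrite /one_step ler_pM2l ?discount_gt0//.
  have := up_prob_gt0; have := up_prob_lt1 => p1 p0.
  by apply: lerD; rewrite ler_pM2l ?subr_gt0// fd ?mulr_gt0// ler_pM2l.
(* Writing [x] as the one-step image of the identity turns the sum into the one-step image of
   [f + id], which is nondecreasing. *)
- rewrite -{2}(one_step_id x) -{2}(one_step_id y) /one_step -!mulrDr.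
  rewrite ler_pM2l ?discount_gt0//.
  rewrite [leLHS]addrACA [leRHS]addrACA -!mulrDr.
  have := up_prob_gt0; have := up_prob_lt1 => p1 p0.
  by apply: lerD; rewrite ler_pM2l ?subr_gt0// fi ?mulr_gt0// ler_pM2l.
Qed.

End one_step_operator.

(** * Exercise regions *)

Section threshold_structure.
Context {R : realType} (r lam K : R).
Context (r_gt0 : 0 < r) (lam_gt1 : 1 < lam)
  (no_arbitrage : lam^-1 < 1 + r < lam) (K_gt0 : 0 < K).

Local Notation g := (put K).
Local Notation A := (one_step r lam).
Local Notation V := (swing_value r lam K).
Local Notation Dlt := (marginal_value r lam K).
Local Notation f := (continuation r lam K).
Local Notation D := (exercise_region r lam K).
Local Notation xstar := (exercise_boundary r lam K).

Lemma swing_value0 n x : V 0 n x = 0.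
Proof. by case: n. Qed.

Lemma one_step_swing_value m n x :
  A (V m.+1 n) x = A (V m n) x + f m.+1 n.+1 x.
Proof. by rewrite /= one_stepB addrC subrK. Qed.

(** Both actions contain [A (V m n)]; taking it out leaves a comparison of the payoff now with the
    value of keeping one more right. *)
Lemma swing_valueS m n x :
  V m.+1 n.+1 x = A (V m n) x + Num.max (g x) (f m.+1 n.+1 x).
Proof. by rewrite addr_maxr -one_step_swing_value [in RHS]addrC. Qed.

Lemma put_ge0 x : 0 <= g x.
Proof. by rewrite le_max lexx orbT. Qed.

Lemma marginal_value1 n x : Dlt 1 n x = Num.max (f 1 n x) (g x).
Proof.
case: n => [|n]; rewrite /marginal_value.
  by rewrite /= subr0 (max_idPr (put_ge0 x)).
rewrite swing_valueS swing_value0 subr0 maxC.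
by rewrite (_ : A _ x = 0) ?add0r// /one_step !swing_value0; ring.
Qed.

(** After cancellation the increment is [f1 + max g f2 - max g f1] with [f2 <= f1], and the three
    positions of [g] give the formula. The order is assumed at one point and one horizon only, so
    that the induction proving it can already use the formula. *)
Lemma marginal_valueS_of_le m n x : f m.+2 n x <= f m.+1 n x ->
  Dlt m.+2 n x = Num.max (f m.+2 n x) (Num.min (g x) (f m.+1 n x)).
Proof.
case: n => [|n] le_f; rewrite /marginal_value.
  by rewrite /= subrr (min_idPr (put_ge0 x)) maxxx.
rewrite !swing_valueS one_step_swing_value.
move: (f m.+2 n.+1 x) (f m.+1 n.+1 x) (A _ x) (g x) le_f => a b c e ab.
by rewrite minEle !maxEle; repeat case: ifPn; rewrite -?ltNge; lra.
Qed.

(** Diminishing marginal value of rights: at horizon [n], [f m.+1 n] separates the two successive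
    increments, lying above [Dlt m.+2 n] and below [Dlt m.+1 n]. Monotonicity of the one-step
    operator carries this to horizon [n.+1]. *)
Lemma continuation_leS m n x : 0 < x -> f m.+2 n x <= f m.+1 n x.
Proof.
elim: n m x => [//|n IHn] m x x0; apply: one_step_le => // y y0.
rewrite marginal_valueS_of_le ?IHn//.
have le_f1 : Num.max (f m.+2 n y) (Num.min (g y) (f m.+1 n y)) <= f m.+1 n y.
  by rewrite ge_max IHn// ge_min lexx orbT.
apply: (le_trans le_f1); case: m {le_f1} => [|m].
  by rewrite marginal_value1 le_max lexx.
by rewrite marginal_valueS_of_le ?IHn// le_max lexx.
Qed.

Lemma marginal_valueS m n x : 0 < x ->
  Dlt m.+2 n x = Num.max (f m.+2 n x) (Num.min (g x) (f m.+1 n x)).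
Proof. by move=> x0; rewrite marginal_valueS_of_le ?continuation_leS. Qed.

Lemma put_like_continuation m n : put_like (f m.+1 n).
Proof.
elim: n m => [|n IHn] m; first exact: put_like0.
apply: put_like_one_step => //; case: m => [|m].
  apply: put_like_eq (put_like_max (IHn 0%N) (put_like_put K)) _ => x _.
  by rewrite marginal_value1.
apply: put_like_eq (put_like_max (IHn m.+1)
  (put_like_min (put_like_put K) (IHn m))) _ => x x0.
by rewrite marginal_valueS.
Qed.

Lemma continuation_ge0 m n x : 0 < x -> 0 <= f m.+1 n x.
Proof. by case: (put_like_continuation m n) => h _ _; apply: h. Qed.

Lemma continuation_le_horizon m n x : 0 < x -> f m.+1 n x <= f m.+1 n.+1 x.
Proof.
elim: n m x => [|n IHn] m x x0; first exact: continuation_ge0.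
apply: one_step_le => // y y0; case: m => [|m].
  rewrite !marginal_value1; move: (g y) => c.
  by rewrite ge_max !le_max lexx IHn// orbT.
rewrite !marginal_valueS//; move: (g y) (IHn m.+1 y y0) (IHn m y y0) => c le1 le2.
by rewrite ge_max !le_max !le_min !ge_min lexx le1 le2/= !orbT.
Qed.

(* With at least as many rights as remaining dates, a right has no
   alternative use. *)
Lemma continuation_eq0 m n x : 0 < x -> (n <= m)%N -> f m.+1 n x = 0.
Proof.
elim: n m x => [//|n IHn] [//|m] x x0 nm.
rewrite /= (@one_step_eq _ _ _ lam_gt1 _ (fun=> 0))//.
  by rewrite one_step_cst mulr0.
move=> y y0; rewrite marginal_valueS// !IHn//; last exact: leqW.
by rewrite (min_idPr (put_ge0 y)) maxxx.
Qed.

Lemma put_le_strike x : 0 < x -> g x <= K.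
Proof. by move=> x0; have K0 := K_gt0; rewrite /put ge_max; lra. Qed.

(** A single right is the worst case by [continuation_leS], and its value never exceeds [K] before
    discounting. Since [r > 0] the bound is strictly below [K], which makes immediate exercise
    profitable near 0. *)
Lemma continuation_le_strike m n x : 0 < x -> f m.+1 n x <= discount r * K.
Proof.
have a0 := discount_gt0 r_gt0; have a1 := discount_lt1 r_gt0.
have K0 := K_gt0.
elim: m n x => [|m IHm] n x x0; last first.
  by rewrite (le_trans (continuation_leS _ _ _))// IHm.
elim: n x x0 => [|n IHn] x x0; first by rewrite mulr_ge0 ?ltW.
rewrite -(one_step_cst r lam K x) /=; apply: one_step_le => // y y0.
rewrite marginal_value1 ge_max put_le_strike// andbT (le_trans (IHn _ y0))//.
by rewrite ler_piMl ?ltW.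
Qed.

Lemma put_subK x : x <= K -> g x = K - x.
Proof. by move=> xK; rewrite /put maxEle; case: ifPn => //; lra. Qed.

Lemma put_ge_strike x : K <= x -> g x = 0.
Proof. by move=> xK; rewrite /put maxEle; case: ifPn => //; rewrite -ltNge; lra. Qed.

(** On [(0, K]] the gain is [K - (f x + x)], and [f x + x] is nondecreasing by the put-like
    property. *)
Lemma exercise_gain_nonincreasing m n x y : 0 < x -> x <= y -> y <= K ->
  g y - f m.+1 n y <= g x - f m.+1 n x.
Proof.
move=> x0 xy yK; rewrite !put_subK//; last by rewrite (le_trans xy).
by have [_ _ /(_ x y x0 xy)] := put_like_continuation m n; lra.
Qed.

Lemma exercise_gain_gt0 m n x : 0 < x -> x < (1 - discount r) * K ->
  0 < g x - f m.+1 n x.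
Proof.
move=> x0 xK; have := continuation_le_strike m n x0.
have a0 := discount_gt0 r_gt0; have K0 := K_gt0.
have aK : 0 < discount r * K by rewrite mulr_gt0.
by rewrite put_subK; lra.
Qed.

Lemma exercise_region_bounded m n : has_ubound (D m n).
Proof. by exists K => x [/andP[]]. Qed.

Lemma exercise_region_nonempty m n : D m.+1 n !=set0.
Proof.
have a0 := discount_gt0 r_gt0; have a1 := discount_lt1 r_gt0.
have K0 := K_gt0.
have aK : 0 < discount r * K by rewrite mulr_gt0.
have aK' : 0 < (1 - discount r) * K by rewrite mulr_gt0 ?subr_gt0.
exists ((1 - discount r) * K / 2); split; first lra.
by rewrite -subr_ge0 ltW// exercise_gain_gt0//; lra.
Qed.

Lemma exercise_boundary_gt0 m n : 0 < xstar m.+1 n.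
Proof.
have [x Dx] := exercise_region_nonempty m n.
have [/andP[x0 _] _] := Dx; apply: lt_le_trans x0 _.
exact: (ub_le_sup (exercise_region_bounded _ _) Dx).
Qed.

Lemma exercise_boundary_le_strike m n : xstar m.+1 n <= K.
Proof. by apply: ge_sup (exercise_region_nonempty m n) _ => x [/andP[]]. Qed.

(** The point at issue is that the supremum belongs to the region. For [y < x] some [z] of the
    region lies beyond [y], whence [f x <= f y <= f z + z - y <= K - y]; letting [y] tend to [x]
    gives [f x <= K - x]. *)
Lemma exercise_regionE m n : D m.+1 n = [set x | 0 < x <= xstar m.+1 n].
Proof.
apply/seteqP; split => [x Dx|x /= /andP[x0 xs]] /=.
  rewrite (ub_le_sup (exercise_region_bounded _ _) Dx) andbT.
  by case: Dx => /andP[].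
have xK := le_trans xs (exercise_boundary_le_strike m n).
split; first by rewrite x0.
have below y : 0 < y -> y < x -> f m.+1 n x <= K - y.
  move=> y0 yx.
  have [z [/andP[z0 zK] fz] yz] := sup_gt (exercise_region_nonempty m n) (lt_le_trans yx xs).
  have [_ fd fi] := put_like_continuation m n.
  rewrite put_subK// in fz.
  by have := fd y x y0 (ltW yx); have := fi y z y0 (ltW yz); lra.
rewrite put_subK// leNgt; apply/negP => fx.
(* If [K - f x < x], the midpoint of these two numbers contradicts [below]; the maximum with [x / 2]
   keeps [y] positive. *)
pose y := Num.max (x / 2) (((K - f m.+1 n x) + x) / 2).
have y0 : 0 < y by rewrite lt_max divr_gt0.
have yx : y < x by rewrite gt_max; lra.
have := below y y0 yx; have : ((K - f m.+1 n x) + x) / 2 <= y by rewrite le_max lexx orbT.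
lra.
Qed.

Lemma exercise_region_horizon m n : D m.+1 n.+1 `<=` D m.+1 n.
Proof.
move=> x [/andP[x0 xK] fx]; split; first by rewrite x0.
exact: le_trans (continuation_le_horizon _ _ x0) fx.
Qed.

Lemma exercise_region_rights m n : D m.+1 n `<=` D m.+2 n.
Proof.
move=> x [/andP[x0 xK] fx]; split; first by rewrite x0.
exact: le_trans (continuation_leS _ _ x0) fx.
Qed.

Lemma exercise_boundary_le m n m' n' : D m.+1 n `<=` D m'.+1 n' ->
  xstar m.+1 n <= xstar m'.+1 n'.
Proof.
move=> sub; apply: ge_sup (exercise_region_nonempty m n) _ => x /sub Dx.
exact: (ub_le_sup (exercise_region_bounded _ _) Dx).
Qed.

(** At [K] the payoff and the continuation value both vanish, so the weak inequality in the region
    admits [K] itself. *)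
Lemma exercise_boundary_eq_strike m n : (n <= m)%N -> xstar m.+1 n = K.
Proof.
move=> nm; apply/eqP; rewrite eq_le exercise_boundary_le_strike/=.
apply: (ub_le_sup (exercise_region_bounded _ _)).
by split; [rewrite K_gt0 lexx|rewrite continuation_eq0// put_ge_strike].
Qed.

Lemma swing_value_exercise m n x : D m.+1 n.+1 x ->
  V m.+1 n.+1 x = g x + A (V m n) x.
Proof. by move=> [_ fx]; rewrite swing_valueS (max_idPl fx) addrC. Qed.

Lemma swing_value_continue m n x : f m.+1 n.+1 x >= g x ->
  V m.+1 n.+1 x = A (V m.+1 n) x.
Proof. by move=> fx; rewrite swing_valueS (max_idPr fx) one_step_swing_value. Qed.

(** The region stops at [K] by definition; beyond [K] the payoff is zero and nonnegativity of the
    continuation value suffices. *)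
Lemma put_le_continuation m n x : 0 < x -> ~ D m.+1 n x -> g x <= f m.+1 n x.
Proof.
move=> x0 nD; have [xK|Kx] := leP x K.
  by rewrite leNgt; apply/negP => fx; apply: nD; split; [rewrite x0|exact: ltW].
rewrite put_ge_strike; last exact: ltW.
exact: continuation_ge0.
Qed.

Lemma swing_value_above_strike m n x : K < x ->
  V m.+1 n.+1 x = A (V m.+1 n) x
  /\ (V m.+1 n.+1 x = g x + A (V m n) x <-> g x = 0 /\ f m.+1 n.+1 x = 0).
Proof.
move=> Kx; have x0 := lt_trans K_gt0 Kx.
have gx : g x = 0 by rewrite put_ge_strike ?ltW.
have fx := continuation_ge0 m n.+1 x0.
have Vx : V m.+1 n.+1 x = A (V m.+1 n) x by rewrite swing_value_continue ?gx.
split=> //; rewrite Vx one_step_swing_value gx add0r.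
by split=> [?|[_ ->]]; [split=> //; lra|rewrite addr0].
Qed.

End threshold_structure.

(** * Controls on the binary tree *)

Section binary_paths.
Context {R : realType}.
Implicit Types (p : R) (F : seq bool -> R) (s : seq bool).

Fixpoint paths (n : nat) : seq (seq bool) :=
  if n is n'.+1 then map (cons true) (paths n') ++ map (cons false) (paths n')
  else [:: [::]].

Lemma mem_paths n s : (s \in paths n) = (size s == n).
Proof.
elim: n s => [|n IHn] [|b s] //=.
  by rewrite mem_cat; apply/negP => /orP[] /mapP[].
rewrite mem_cat eqSS -IHn; apply/orP/idP => [[] /mapP[t + [_ ->]] //|sn].
by case: b; [left|right]; apply: map_f.
Qed.

Lemma uniq_paths n : uniq (paths n).
Proof.
elim: n => //= n IHn; rewrite cat_uniq !map_inj_uniq ?IHn; try by move=> s t [].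
by rewrite andbT; apply/hasPn => _ /mapP[t _ ->]; apply/negP => /mapP[].
Qed.

(** Expectation over [n] independent tosses, computed by conditioning on the first one, in the shape
    needed by backward induction; [path_meanE] recovers the weighted sum over paths. *)
Fixpoint path_mean p n F : R :=
  if n is n'.+1 then
    p * path_mean p n' (fun s => F (true :: s))
    + (1 - p) * path_mean p n' (fun s => F (false :: s))
  else F [::].

Definition path_weight p s : R := \prod_(b <- s) (if b then p else 1 - p).

Lemma path_meanE p n F :
  path_mean p n F = \sum_(s <- paths n) path_weight p s * F s.
Proof.
elim: n F => [|n IHn] F /=; first by rewrite big_seq1 /path_weight big_nil mul1r.
rewrite !IHn big_cat !big_map !big_distrr /=.
by congr (_ + _); apply: eq_bigr => s _; rewrite /path_weight big_cons mulrA.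
Qed.

Lemma eq_path_mean p n F F' : (forall s, size s = n -> F s = F' s) ->
  path_mean p n F = path_mean p n F'.
Proof.
elim: n F F' => [|n IHn] F F' eqF /=; first exact: eqF.
by congr (_ * _ + _ * _); apply: IHn => s sn; apply: eqF; rewrite /= sn.
Qed.

Lemma path_mean_affine p n F c a :
  path_mean p n (fun s => c + a * F s) = c + a * path_mean p n F.
Proof. by elim: n F => [|n IHn] F //=; rewrite !IHn; ring. Qed.

End binary_paths.

Section controls.
Context {R : realType} (r lam K : R).
Context (r_gt0 : 0 < r) (lam_gt1 : 1 < lam)
  (no_arbitrage : lam^-1 < 1 + r < lam) (K_gt0 : 0 < K).
Implicit Types (x : R) (a : seq bool -> bool) (s : seq bool).

Local Notation g := (put K).
Local Notation A := (one_step r lam).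
Local Notation V := (swing_value r lam K).
Local Notation D := (exercise_region r lam K).
Local Notation p := (up_prob r lam).

Definition move_price x (b : bool) : R := if b then lam * x else lam^-1 * x.

Definition price_after x s : R := foldl move_price x s.

(* A control [a] decides, from the price moves observed so far, whether a right
   is exercised now. *)
Definition control_payoff a x s : R :=
  \sum_(k < (size s).+1)
    if a (take k s) then discount r ^+ k * g (price_after x (take k s)) else 0.

Definition exercise_count a s : nat := \sum_(k < (size s).+1) a (take k s).

Definition shift a b : seq bool -> bool := fun s => a (b :: s).

(** Expected payoff of [a], unfolded at the first move so that it can be compared term by term with
    the recursion defining [V]. *)
Fixpoint control_value n a x : R :=
  (if a [::] then g x else 0) +
  (if n is n'.+1 then
     discount r * (p * control_value n' (shift a true) (lam * x)
                   + (1 - p) * control_value n' (shift a false) (lam^-1 * x))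
   else 0).

Lemma control_payoff_cons a x b s :
  control_payoff a x (b :: s) =
  (if a [::] then g x else 0)
  + discount r * control_payoff (shift a b) (move_price x b) s.
Proof.
rewrite /control_payoff /= big_ord_recl /= expr0 mul1r; congr (_ + _).
rewrite big_distrr /=; apply: eq_bigr => k _; rewrite /shift /=.
by case: ifP => _; rewrite ?mulr0// exprS mulrA.
Qed.

Lemma exercise_count_cons a b s :
  exercise_count a (b :: s) = (a [::] + exercise_count (shift a b) s)%N.
Proof. by rewrite /exercise_count /= big_ord_recl. Qed.

Lemma path_mean_control_payoff n a x :
  path_mean p n (control_payoff a x) = control_value n a x.
Proof.
elim: n a x => [|n IHn] a x.
  by rewrite /= /control_payoff big_ord1 expr0 mul1r addr0.
rewrite /= -(IHn _ (lam * x)) -(IHn _ (lam^-1 * x)).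
under eq_path_mean do rewrite control_payoff_cons.
under [X in _ + _ * X]eq_path_mean do rewrite control_payoff_cons.
by rewrite !path_mean_affine; ring.
Qed.

Let move_gt0 x b : 0 < x -> 0 < move_price x b.
Proof.
have l1 := lam_gt1; have l0 : 0 < lam by lra.
by case: b => x0; rewrite /= mulr_gt0// invr_gt0.
Qed.

(** Backward induction: the decision at the root leaves [m - a [::]] rights to each subtree, and [V]
    takes the better of the two decisions. *)
Lemma control_value_le_swing_value n m a x : 0 < x ->
  (forall s, size s = n -> (exercise_count a s <= m)%N) ->
  control_value n a x <= V m n x.
Proof.
have a0 := discount_gt0 r_gt0.
have p0 := up_prob_gt0 no_arbitrage.
have p1 := up_prob_lt1 no_arbitrage.
elim: n m a x => [|n IHn] m a x x0 am.
  have := am [::] erefl; rewrite /= /exercise_count big_ord1 addr0 /=.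
  by case: m {am} => [|m]; case: (a [::]) => //= _; exact: put_ge0.
have count b s : size s = n ->
    (exercise_count (shift a b) s <= m - a [::])%N.
  by move=> sn; have := am (b :: s); rewrite exercise_count_cons /= sn; lia.
have step : discount r * (p * control_value n (shift a true) (lam * x)
      + (1 - p) * control_value n (shift a false) (lam^-1 * x))
    <= A (V (m - a [::]) n) x.
  rewrite ler_pM2l//; apply: lerD; rewrite ler_pM2l ?subr_gt0//; apply: IHn.
  - exact: (move_gt0 true x0).
  - exact: count.
  - exact: (move_gt0 false x0).
  - exact: count.
apply: (@le_trans _ _ ((if a [::] then g x else 0) + A (V (m - a [::]) n) x)).
  by rewrite /= lerD2l.
(* Any path will do: the bound on its count already covers the root, so the truncated subtraction
   above loses nothing. *)
have : (a [::] <= m)%N.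
  have := am (nseq n.+1 true); rewrite exercise_count_cons size_nseq.
  by move=> /(_ erefl); lia.
case: m {am count step} => [|m]; case: (a [::]) => //= _.
- by rewrite add0r /one_step !swing_value0 !mulr0 addr0 mulr0.
- by rewrite subSS subn0 le_max lexx.
- by rewrite add0r le_max lexx orbT.
Qed.

(** [c] counts the rights used strictly before [s], so the next exercise is governed by the region
    for [m - c] rights. The test [c < m] matters: the region for 0 rights is the whole of
    [(0, K]]. *)
Definition is_threshold_control n m a x : Prop :=
  forall s, (size s <= n)%N ->
    let c := (\sum_(k < size s) a (take k s))%N in
    a s = ((c < m)%N && (price_after x s \in D (m - c) (n - size s))).

Lemma control_value_threshold n m a x : 0 < x -> is_threshold_control n m a x ->
  control_value n a x = V m n x.
Proof.
elim: n m a x => [|n IHn] m a x x0 thr.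
  have := thr [::] erefl; rewrite /= big_ord0 addr0 subn0.
  case: m {thr} => [|m] -> //=; case: ifPn => //= /negP nD; apply/esym.
  have {}nD : ~ D m.+1 0 x by move=> Dx; apply: nD; exact: mem_set.
  have := put_le_continuation r_gt0 lam_gt1 no_arbitrage x0 nD.
  have := put_ge0 K x; rewrite /=; lra.
have step : discount r * (p * control_value n (shift a true) (lam * x)
      + (1 - p) * control_value n (shift a false) (lam^-1 * x))
    = A (V (m - a [::]) n) x.
  (* The decision at the root moves from the count of used rights to the number of rights
     available. *)
  have sub b : is_threshold_control n (m - a [::]) (shift a b) (move_price x b).
    move=> s sn /=; rewrite {1}/shift thr//= big_ord_recl /=.
    by rewrite subSS subnDA ltn_subRL.
  by rewrite (IHn _ _ _ (move_gt0 true x0) (sub true))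
    (IHn _ _ _ (move_gt0 false x0) (sub false)).
rewrite /= in step *; rewrite step.
have := thr [::] erefl; rewrite /= big_ord0 subn0.
case: m {thr step} => [|m] ->.
  by rewrite add0r /one_step !swing_value0 !mulr0 addr0 mulr0.
case: ifPn => [/set_mem Dx|/negP nD].
  by rewrite subSS subn0 -[RHS]/(V m.+1 n.+1 x) swing_value_exercise.
rewrite subn0 add0r -[RHS]/(V m.+1 n.+1 x) swing_value_continue//.
by apply: put_le_continuation => // Dx; apply: nD; exact: mem_set.
Qed.

End controls.

(** * Successive exercise times *)

Section first_time_theory.
Context {N : nat}.
Implicit Types (Q : pred 'I_N.+1) (k nu : 'I_N.+1).

Lemma first_time_Some Q k : first_time Q = Some k -> Q k.
Proof.
rewrite /first_time => Qk.
have : k \in [seq nu <- enum 'I_N.+1 | Q nu].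
  by case: [seq _ <- _ | _] Qk => //= x s [->]; rewrite mem_head.
by rewrite mem_filter => /andP[].
Qed.

(** The enumeration of ordinals is increasing, hence so is its filtered sublist, and the head of
    that list is minimal. *)
Lemma first_time_le Q nu : Q nu ->
  exists2 k, first_time Q = Some k & (k <= nu)%N.
Proof.
move=> Qnu; rewrite /first_time.
have : nu \in [seq nu <- enum 'I_N.+1 | Q nu] by rewrite mem_filter Qnu mem_enum.
have : sorted (fun i j : 'I_N.+1 => (i < j)%N) [seq nu <- enum 'I_N.+1 | Q nu].
  apply: sorted_filter; first by move=> x y z; exact: ltn_trans.
  by have := iota_ltn_sorted 0 N.+1; rewrite -val_enum_ord sorted_map.
case: [seq _ <- _ | _] => //= x s xs.
rewrite inE => /predU1P[->|nus]; exists x => //; apply: ltnW.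
have tr : transitive (fun i j : 'I_N.+1 => (i < j)%N) by move=> ? ? ?; exact: ltn_trans.
by have /allP /(_ _ nus) := order_path_min tr xs.
Qed.

End first_time_theory.

(** The date is a plain natural number so that it can be the length of a sequence of moves. *)
Definition exercised_at {m N : nat} (t : 'I_m -> option 'I_N.+1) (k : nat) :=
  [exists j, omap val (t j) == Some k].

Lemma exercise_pattern_inj m N (t : 'I_m -> option 'I_N.+1) i j k :
  exercise_pattern t -> t i = Some k -> t j = Some k -> i = j.
Proof.
move=> [_ inc] ti tj; apply/val_inj => /=.
by have [ij|ij|//] := ltngtP i j;
  [have := inc _ _ _ _ ij ti tj|have := inc _ _ _ _ ij tj ti]; rewrite ltnn.
Qed.

(** Passes from a sum over rights to a sum over dates: finite entries strictly increase, so no date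
    is hit twice. The operation is arbitrary because both payoffs and numbers of exercises are
    summed this way. *)
Lemma big_exercised {V : Type} {idx : V} {op : Monoid.com_law idx} m N
    (t : 'I_m -> option 'I_N.+1) (G : nat -> V) : exercise_pattern t ->
  \big[op/idx]_(j < m) (if t j is Some nu then G nu else idx)
  = \big[op/idx]_(k < N.+1) (if exercised_at t k then G k else idx).
Proof.
move=> pat.
transitivity (\big[op/idx]_(j < m) \big[op/idx]_(k < N.+1)
    (if t j == Some k then G k else idx)).
  apply: eq_bigr => j _; case tj : (t j) => [nu|]; last by rewrite big1.
  rewrite -big_mkcond (big_pred1 nu)//.
rewrite exchange_big; apply: eq_bigr => k _ /=; rewrite -big_mkcond.
rewrite /exercised_at; case: existsP => [[j tj]|nex].
  have {}tj : t j = Some k.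
    by case: (t j) tj => [i /eqP[ik]|//]; congr Some; apply: val_inj.
  rewrite (big_pred1 j)// => i /=; apply/eqP/eqP => [ti|->//].
  exact: exercise_pattern_inj ti tj.
rewrite big_pred0// => j; apply/negP => /eqP tj.
by apply: nex; exists j; rewrite tj.
Qed.

Section successive_times.
Context {N : nat} (Q : nat -> pred 'I_N.+1) (t : nat -> option 'I_N.+1).
Context (t0E : t 0%N = first_time (Q 0%N)).
Context (tSE : forall j,
  t j.+1 = first_time (fun nu => strictly_after (t j) nu && Q j.+1 nu)).

Lemma successive_None i j : (i <= j)%N -> t i = None -> t j = None.
Proof.
move=> ij ti; elim: j ij => [|j IHj]; first by rewrite leqn0 => /eqP <-.
rewrite leq_eqVlt => /predU1P[<-//|/IHj tj].
case tj1 : (t j.+1) => [k|//]; move: tj1; rewrite tSE => /first_time_Some.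
by rewrite tj.
Qed.

Lemma successive_lt i j u v : (i < j)%N -> t i = Some u -> t j = Some v ->
  (u < v)%N.
Proof.
elim: j v => // j IHj v ij ti; rewrite tSE => /first_time_Some/andP[+ _].
case tj : (t j) => [w|//] /= wv.
move: ij; rewrite ltnS leq_eqVlt => /predU1P[ij|ij].
  by move: ti; rewrite ij tj => -[<-].
exact: ltn_trans (IHj w ij ti tj) wv.
Qed.

Lemma successive_pattern m : exercise_pattern (fun j : 'I_m => t j).
Proof.
split; last by move=> i j u v; exact: successive_lt.
(* The number of exercised rights is the first position holding [None]; by [successive_None] all
   later ones hold it too. *)
exists (find (fun j => t j == None) (iota 0 m)).
  by rewrite -[leqRHS](size_iota 0) find_size.
move=> j; apply/idP/idP => [|jf].
  apply: contraR; rewrite -leqNgt => fj.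
  have fm : (find (fun j => t j == None) (iota 0 m) < m)%N.
    exact: leq_ltn_trans fj (ltn_ord j).
  apply/eqP/(successive_None fj)/eqP.
  have := nth_find 0%N (_ : has (fun j => t j == None) (iota 0 m)).
  by rewrite has_find size_iota fm nth_iota//; exact.
by have := before_find 0%N jf; rewrite nth_iota ?add0n// => ->.
Qed.

Local Notation exercised m := (exercised_at (fun j : 'I_m => t j)).

Let before (nu j : nat) : bool := if t j is Some k then (k < nu)%N else false.

(** All rights preceding [c] are used before [nu], so [nu] is a candidate for [t c] once [Q c nu]
    holds; minimality gives [t c <= nu], and [t c < nu] is excluded. *)
Lemma successive_next (nu : 'I_N.+1) c : before nu c = false ->
  (forall i, (i < c)%N -> before nu i) -> (t c == Some nu) = Q c nu.
Proof.
move=> bc bi; apply/eqP/idP => [|Qc].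
  by case: c {bc bi} => [|c]; rewrite ?t0E ?tSE => /first_time_Some // /andP[].
have [k tk knu] : exists2 k, t c = Some k & (k <= nu)%N.
  case: c Qc {bc} bi => [|c] Qc bi; rewrite ?t0E ?tSE; apply: first_time_le => //.
  by rewrite Qc andbT; have := bi c (ltnSn c); rewrite /before /strictly_after.
by move: bc; rewrite /before tk => knu'; congr Some; apply/val_inj => /=; lia.
Qed.

(* The right exercised at [nu], if any, is the first one not used before. *)
Lemma exercised_atE m (nu : 'I_N.+1) :
  let c := (\sum_(k < nu) exercised m k)%N in
  exercised m nu = (c < m)%N && Q c nu.
Proof.
pose c nu := (\sum_(k < nu) exercised m k)%N.
(* Only the right at position [c n] can be exercised at date [n]: earlier ones are used up, and a
   later one would force [t (c n)] to fall before [n]. *)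
have key n (nN : (n < N.+1)%N) : (c n <= m)%N ->
   (forall j, (j < m)%N -> before n j = (j < c n)%N) ->
   exercised m n = (c n < m)%N && (t (c n) == Some (Ordinal nN)).
  move=> cm bc; apply/existsP/andP => [[j /eqP tj]|[cltm /eqP tc]]; last first.
    by exists (Ordinal cltm); rewrite /= tc.
  have [k tk kn] : exists2 k, t j = Some k & val k = n.
    by case: (t j) tj => [k|//] [<-]; exists k.
  have cj : (c n <= j)%N.
    have := bc _ (ltn_ord j); rewrite /before tk kn ltnn => /esym/negbT.
    by rewrite -leqNgt.
  have cltm : (c n < m)%N := leq_ltn_trans cj (ltn_ord j).
  split=> //; move: cj; rewrite leq_eqVlt => /predU1P[->|cj].
    by rewrite tk; apply/eqP; congr Some; apply: val_inj.
  have := bc _ cltm; rewrite ltnn /before.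
  case tc : (t (c n)) => [v|]; last by rewrite (successive_None (ltnW cj) tc) in tk.
  by have := successive_lt cj tc tk; rewrite kn => ->.
(* The rights used before date [n] are exactly the first [c n] positions. *)
have inv n : (n <= N)%N ->
   (c n <= m)%N /\ (forall j, (j < m)%N -> before n j = (j < c n)%N).
  elim: n => [_|n IHn nN].
    rewrite /c big_ord0; split=> // j _; rewrite /before ltn0.
    by case: (t j).
  have [cm bc] := IHn (ltnW nN).
  have nN1 : (n < N.+1)%N by exact: ltnW.
  have E := key n nN1 cm bc.
  have cS : c n.+1 = (c n + exercised m n)%N by rewrite /c big_ord_recr.
  have bS j : before n.+1 j = before n j || (omap val (t j) == Some n).
    rewrite /before; case: (t j) => //= k.
    by rewrite ltnS leq_eqVlt orbC; congr (_ || _); apply/eqP/eqP => [->|[->]].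
  split; first by rewrite cS E; lia.
  move=> j jm; rewrite bS bc// cS.
  have [tj|ntj] := boolP (omap val (t j) == Some n).
    have Enu : exercised m n by apply/existsP; exists (Ordinal jm).
    rewrite orbT Enu; move: Enu; rewrite E => /andP[cltm /eqP tc].
    have [|//|] := ltngtP j (c n); [lia| |lia].
    move=> cj; move: tj.
    case tj : (t j) => [v|//] /= /eqP[vn].
    by have := successive_lt cj tc tj; rewrite /= vn ltnn.
  rewrite orbF; have [Enu|_] := boolP (exercised m n); last by rewrite addn0.
  move: Enu; rewrite E => /andP[cltm /eqP tc].
  by have [//| |jc] := ltngtP j (c n); [lia|lia|move: ntj; rewrite jc tc /= eqxx].
have /inv[cm bc] : (nu <= N)%N by rewrite -ltnS.
move=> /=.
rewrite (key _ (ltn_ord nu) cm bc); have [cltm|//] := boolP (c nu < m)%N.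
rewrite /= -/(c nu) (_ : Ordinal _ = nu); last exact: val_inj.
apply: successive_next; first by rewrite bc// ltnn.
by move=> i ic; rewrite bc// (ltn_trans ic).
Qed.

End successive_times.

(** * The natural filtration *)

Section natural_filtration_theory.
Context {d : measure_display} {Omega : measurableType d} {R : realType}.
Context (S : nat -> Omega -> R).
Implicit Types (A B : set Omega) (nu : nat).

Local Notation F := (natural_filtration S).

(** Induction principle for events: a property stable under the operations of a sigma-algebra is
    checked on preimages under single prices. *)
Lemma natural_filtration_sub nu (G : set (set Omega)) :
  sigma_algebra setT G ->
  (forall k (B : set R), (k <= nu)%N -> measurable B -> G (S k @^-1` B)) ->
  F nu `<=` G.
Proof.
move=> sG subG; apply: smallest_sub => //; rewrite -bigcup_mkord_ord.
move=> _ [i _ [B mB <-]]; rewrite setTI; apply: subG => //.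
by rewrite -ltnS.
Qed.

Lemma natural_filtration_sigma_algebra nu : sigma_algebra setT (F nu).
Proof. exact: smallest_sigma_algebra. Qed.

Lemma natural_filtration_preimage nu k (B : set R) : (k <= nu)%N ->
  measurable B -> F nu (S k @^-1` B).
Proof.
move=> kn mB; apply: sub_sigma_algebra; rewrite -bigcup_mkord_ord.
by exists k; rewrite //= inordK//; exists B; rewrite ?setTI.
Qed.

Lemma natural_filtration_mono nu nu' : (nu <= nu')%N -> F nu `<=` F nu'.
Proof.
move=> nn'; apply: natural_filtration_sub.
  exact: natural_filtration_sigma_algebra.
move=> k B kn; apply: natural_filtration_preimage; exact: leq_trans nn'.
Qed.

Lemma natural_filtration_measurable nu : (forall k, measurable_fun setT (S k)) ->
  F nu `<=` measurable.
Proof.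
move=> mS; apply: natural_filtration_sub.
  by split=> [|A mA|A mA]; [|exact: measurableD|exact: bigcupT_measurable].
by move=> k B _ mB; rewrite -[_ @^-1` _]setTI; exact: mS.
Qed.

(** The events that do not separate [w] from [w'] form a sigma-algebra containing the generators.
    This turns adaptedness into dependence on observed prices alone. *)
Lemma natural_filtration_saturated nu A w w' : F nu A ->
  (forall k, (k <= nu)%N -> S k w = S k w') -> A w <-> A w'.
Proof.
move=> FA eqS; move: A FA; apply: (@natural_filtration_sub nu
  [set A | A w <-> A w']).
  split=> [//|A /= Aw|A /= Aw]; first by rewrite /setD/=; tauto.
  by split=> -[k _ Ak]; exists k => //; apply/Aw.
by move=> k B kn _ /=; rewrite /preimage/= eqS.
Qed.

Lemma natural_filtration0 nu : F nu set0.
Proof. by have [] := natural_filtration_sigma_algebra nu. Qed.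

Lemma natural_filtrationC nu A : F nu A -> F nu (~` A).
Proof.
by have [_ h _] := natural_filtration_sigma_algebra nu; move=> /h; rewrite setTD.
Qed.

Lemma natural_filtration_bigcup nu (A : nat -> set Omega) :
  (forall k, F nu (A k)) -> F nu (\bigcup_k A k).
Proof. by have [_ _] := natural_filtration_sigma_algebra nu; exact. Qed.

Lemma natural_filtrationU nu A B : F nu A -> F nu B -> F nu (A `|` B).
Proof.
move=> FA FB; rewrite -bigcup2E; apply: natural_filtration_bigcup => -[|[|k]] //=.
exact: natural_filtration0.
Qed.

Lemma natural_filtrationI nu A B : F nu A -> F nu B -> F nu (A `&` B).
Proof.
move=> FA FB; rewrite -[A `&` B]setCK setCI; apply: natural_filtrationC.
by apply: natural_filtrationU; exact: natural_filtrationC.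
Qed.

(** The event is the difference of those for dates up to [k] and up to [k.-1]; date 0 is treated
    apart because [0.-1] is 0. *)
Lemma stopping_time_eq N (tau : Omega -> option 'I_N.+1) (k : 'I_N.+1) :
  stopping_time S tau -> F k [set w | tau w = Some k].
Proof.
move=> st; have kN : (k <= N)%N by rewrite -ltnS.
rewrite (_ : [set w | _] =
   [set w | exists2 i : 'I_N.+1, tau w = Some i & (i <= k)%N] `&`
   ~` (if k == 0%N :> nat then set0 else
       [set w | exists2 i : 'I_N.+1, tau w = Some i & (i <= k.-1)%N])).
  apply: natural_filtrationI; first exact: st.
  apply: natural_filtrationC; case: ifPn => [_|k0].
    exact: natural_filtration0.
  apply: (natural_filtration_mono (leq_pred k)); apply: st.
  exact: leq_trans (leq_pred k) kN.
apply/seteqP; split=> w /=.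
  move=> tw; split; first by exists k.
  by case: ifPn => [_ []|k0 [i]]; rewrite tw => -[<-]; lia.
move=> [[i tw ik]]; rewrite tw; case: ifPn => [/eqP k0 _|k0 nik].
  by congr Some; apply/val_inj => /=; lia.
congr Some; apply/val_inj => /=; apply/eqP; rewrite eqn_leq ik leqNgt /=.
by apply/negP => ik'; apply: nik; exists i => //; lia.
Qed.

(** The first time is at most [nu] exactly when [Q] holds at some date up to [nu]; this finite union
    is padded with empty sets to a countable one. *)
Lemma stopping_time_first_time N (Q : 'I_N.+1 -> Omega -> bool) :
  (forall k : 'I_N.+1, F k [set w | Q k w]) ->
  stopping_time S (fun w => first_time (fun k => Q k w)).
Proof.
move=> FQ nu nuN.
rewrite (_ : [set w | _] = \bigcup_k (if (k <= nu)%N then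
   [set w | Q (inord k) w] else set0)).
  apply: natural_filtration_bigcup => k; case: ifPn => [kn|_].
    have := FQ (inord k); rewrite inordK ?ltnS ?(leq_trans kn)//.
    exact: natural_filtration_mono.
  exact: natural_filtration0.
apply/seteqP; split=> w /= [k].
  by move=> /first_time_Some Qk kn; exists k => //=; rewrite kn inord_val.
case: ifPn => // kn _ /= Qk.
have [i ti ik] := @first_time_le _ (fun k => Q k w) _ Qk; exists i => //.
by rewrite (leq_trans ik)// inordK// ltnS (leq_trans kn).
Qed.

Lemma strictly_after_filtration N (tau : Omega -> option 'I_N.+1) (k : 'I_N.+1) :
  stopping_time S tau -> F k [set w | strictly_after (tau w) k].
Proof.
move=> st; have kN : (k <= N)%N by rewrite -ltnS.
have [k0|k0] := posnP k.
  rewrite (_ : [set w | _] = set0); first exact: natural_filtration0.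
  by apply/seteqP; split=> w //=; case: (tau w) => //= i; rewrite k0.
apply: (natural_filtration_mono (leq_pred k)).
rewrite (_ : [set w | _] =
  [set w | exists2 i : 'I_N.+1, tau w = Some i & (i <= k.-1)%N]).
  apply: st; exact: leq_trans (leq_pred k) kN.
apply/seteqP; split=> w /=.
  by case: (tau w) => //= i ik; exists i => //; lia.
by move=> [i -> /= ik]; lia.
Qed.

End natural_filtration_theory.

(** * Expectations along the binary tree *)

Section coin_tosses.
Context {R : realType} (p : R) (N : nat).
Context {d : measure_display} {Omega : measurableType d}
  (P : probability Omega R) (eps : nat -> {RV P >-> R}).
Context (p_gt0 : 0 < p) (p_lt1 : p < 1).
Context (eps_indep : mutually_independent P [set k | (1 <= k <= N)%N]
                 (fun k => eps k : Omega -> R))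
  (eps_up : forall k, (1 <= k <= N)%N -> P (eps k @^-1` [set 1]) = p%:E)
  (eps_down : forall k, (1 <= k <= N)%N ->
     P (eps k @^-1` [set -1]) = (1 - p)%:E).
Implicit Types (s : seq bool) (w : Omega).

Definition move_sign (b : bool) : R := if b then 1 else -1.

(** Tosses are numbered from 1 and moves from 0, hence the shift. *)
Definition cylinder s : set Omega :=
  [set w | forall i, (i < size s)%N -> eps i.+1 w = move_sign (nth true s i)].

Lemma cylinderE s : cylinder s =
  \bigcap_(k in [set` [fset k in iota 1 (size s)]%fset])
    (eps k : Omega -> R) @^-1` [set move_sign (nth true s k.-1)].
Proof.
apply/seteqP; split=> w /= cw => [k|i isz].
  by rewrite /= inE mem_iota => /andP[]; case: k => // k _ ks; apply: cw.
by apply: (cw i.+1); rewrite /= inE mem_iota.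
Qed.

Lemma measurable_cylinder s : measurable (cylinder s).
Proof.
rewrite cylinderE; apply: fin_bigcap_measurable; first exact: finite_fset.
by move=> k _; rewrite -[_ @^-1` _]setTI; apply: measurable_funPT.
Qed.

Lemma probability_cylinder s : (size s <= N)%N ->
  P (cylinder s) = (path_weight p s)%:E.
Proof.
move=> sN; rewrite cylinderE eps_indep//; last first.
  by move=> k /=; rewrite inE mem_iota => /andP[k1 ks]; rewrite k1; lia.
rewrite (perm_big (iota 1 (size s))); last first.
  apply: uniq_perm; [exact: fset_uniq|exact: iota_uniq|].
  by move=> k; rewrite inE.
rewrite big_seq (eq_bigr (fun k =>
    (if nth true s k.-1 then p else 1 - p)%:E)); last first.
  move=> k; rewrite mem_iota => /andP[k1 ks].
  have kN : (1 <= k <= N)%N by rewrite k1; lia.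
  by rewrite /move_sign; case: ifP => _; [rewrite eps_up|rewrite eps_down].
rewrite -big_seq (iotaDl 1 0) big_map /path_weight (big_nth true) prodEFin.
by rewrite /index_iota subn0.
Qed.

(** Its probability is a product of positive factors. The lemma provides an outcome realising a
    given path, through which pathwise properties of policies pass to controls. *)
Lemma cylinder_nonempty s : (size s <= N)%N -> cylinder s !=set0.
Proof.
move=> sN; apply/set0P/eqP => cyl0; have := probability_cylinder sN.
rewrite cyl0 measure0 => -[] /esym/eqP; apply/negP; rewrite gt_eqF//.
by apply: prodr_gt0 => b _; case: b => //; rewrite subr_gt0.
Qed.

Lemma trivIset_cylinder : trivIset [set` paths N] cylinder.
Proof.
move=> s s'; rewrite /= !mem_paths => /eqP sN /eqP sN' [w [cw cw']].
apply: (@eq_from_nth _ true); rewrite ?sN ?sN'// => i iN.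
have : move_sign (nth true s i) = move_sign (nth true s' i).
  by rewrite -cw ?sN// cw' ?sN'.
by case: nth; case: nth => //; rewrite /move_sign; lra.
Qed.

Lemma path_weight_sum n : \sum_(s <- paths n) path_weight p s = 1.
Proof.
transitivity (path_mean p n (fun=> 1)).
  by rewrite path_meanE; apply: eq_bigr => s _; rewrite mulr1.
by elim: n => //= n ->; ring.
Qed.

Let Omega_N := \big[setU/set0]_(s <- paths N) cylinder s.

Let measurable_Omega_N : measurable Omega_N.
Proof. by apply: bigsetU_measurable => s _; exact: measurable_cylinder. Qed.

(** The tosses take the values 1 and -1 only almost surely; the exceptional set is null because the
    path weights sum to 1. *)
Lemma probability_all_cylinders : P (~` Omega_N) = 0%E.
Proof.
rewrite probability_setC//.
suff -> : P Omega_N = 1%E by rewrite subee.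
rewrite /Omega_N -bigcup_seq measure_fin_bigcup//; last 2 first.
- exact: trivIset_cylinder.
- by move=> s _; exact: measurable_cylinder.
rewrite -fsbig_seq ?uniq_paths// -(path_weight_sum N) -sumEFin.
rewrite big_seq [RHS]big_seq; apply: eq_bigr => s.
by rewrite mem_paths => /eqP sN; apply: probability_cylinder; rewrite sN.
Qed.

(** Off a null set the space is a disjoint union of cylinders on which [X] is constant.
    Nonnegativity allows the integral to be split without an integrability argument. *)
Lemma expectation_path_mean (X : Omega -> R) (F : seq bool -> R) :
  measurable_fun setT X -> (forall w, 0 <= X w) ->
  (forall s w, size s = N -> cylinder s w -> X w = F s) ->
  'E_P[X]%E = (path_mean p N F)%:E.
Proof.
move=> mX X0 XF; rewrite unlock.
have mX' := (measurable_EFinP setT X).2 mX.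
rewrite (ge0_negligible_integral (measurableC measurable_Omega_N))//; first last.
- exact: probability_all_cylinders.
- by move=> w _; rewrite lee_fin.
rewrite setTD setCK ge0_integral_bigsetU//; first last.
- by move=> w _; rewrite lee_fin.
- exact: measurable_funTS.
- exact: trivIset_cylinder.
- exact: uniq_paths.
- exact: measurable_cylinder.
rewrite path_meanE -sumEFin big_seq [RHS]big_seq; apply: eq_bigr => s.
rewrite mem_paths => /eqP sN.
rewrite (eq_integral (cst (F s)%:E)); last first.
  by move=> w /set_mem cw; rewrite (XF s).
transitivity ((F s)%:E * P (cylinder s))%E.
  exact: (integral_cst _ (measurable_cylinder s)).
by rewrite probability_cylinder ?sN// EFinM muleC.
Qed.

End coin_tosses.

(** * Exercise policies *)

Section exercise_policies.
Context {R : realType} (r lam K S0 : R) (m N : nat)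
  {d : measure_display} {Omega : measurableType d} (P : probability Omega R)
  (eps : nat -> {RV P >-> R}).
Context (r_gt0 : 0 < r) (lam_gt1 : 1 < lam) (no_arbitrage : lam^-1 < 1 + r < lam)
  (K_gt0 : 0 < K) (S0_gt0 : 0 < S0).
Context (eps_indep : mutually_independent P [set k | (1 <= k <= N)%N]
                 (fun k => eps k : Omega -> R))
  (eps_up : forall k, (1 <= k <= N)%N ->
     P (eps k @^-1` [set 1]) = (up_prob r lam)%:E)
  (eps_down : forall k, (1 <= k <= N)%N ->
     P (eps k @^-1` [set -1]) = (1 - up_prob r lam)%:E).
Implicit Types (s : seq bool) (w : Omega)
  (tau : 'I_m -> Omega -> option 'I_N.+1).

Local Notation S := (price S0 lam (fun k => eps k : Omega -> R)).
Local Notation cyl := (cylinder eps).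

Lemma cylinder_take s k w : cyl s w -> cyl (take k s) w.
Proof.
move=> cw i; rewrite size_take_min leq_min => /andP[ik isz].
by rewrite cw// nth_take.
Qed.

Lemma price_cylinder s w : cyl s w -> S (size s) w = price_after lam S0 s.
Proof.
have l1 := lam_gt1; have l0 : lam != 0 by rewrite gt_eqF//; lra.
elim/last_ind: s => [|s b IHs] cw.
  by rewrite /price /= big_geq// powRr0 mulr1.
have /IHs : cyl s w by have := @cylinder_take _ (size s) _ cw; rewrite -cats1 take_size_cat.
rewrite /price_after foldl_rcons size_rcons /price => <-.
rewrite big_nat_recr//= powRD; last by rewrite l0 implybT.
have := cw (size s); rewrite size_rcons ltnSn nth_rcons ltnn eqxx => -> //.
have lam_ge0 : 0 <= lam by lra.
by rewrite mulrA mulrC /move_price; case: (b); rewrite /move_sign ?powRr1 ?powR_inv1.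
Qed.

Lemma price_cylinder_take s w k : cyl s w -> (k <= size s)%N ->
  S k w = price_after lam S0 (take k s).
Proof.
move=> cw ks; rewrite -(price_cylinder (cylinder_take (k := k) cw)).
by rewrite size_takel.
Qed.

Lemma measurable_price k : measurable_fun setT (S k).
Proof.
apply: measurable_funM; first exact: measurable_cst.
apply: measurableT_comp; first exact: measurable_powRr.
by apply: measurable_sum => i; exact: measurable_funPT.
Qed.

(** The decision is read off some outcome through [s]; for an admissible policy every such outcome
    agrees, by [control_ofE]. *)
Definition control_of tau s : bool :=
  `[< exists2 w, cyl s w & exercised_at (fun j => tau j w) (size s) >].

(** Outcomes in one cylinder share all prices up to date [size s], and the event of exercising a
    given right then cannot separate them. *)
Lemma exercised_at_cylinder tau s w w' : admissible S m N tau ->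
  (size s <= N)%N -> cyl s w -> cyl s w' ->
  exercised_at (fun j => tau j w) (size s) ->
  exercised_at (fun j => tau j w') (size s).
Proof.
move=> [st _] sN cw cw' /existsP[j tj]; apply/existsP; exists j.
have tw : tau j w = Some (Ordinal (sN : (size s < N.+1)%N)).
  by case: (tau j w) tj => [i /eqP[ik]|//]; congr Some; apply: val_inj.
have Ftau := @stopping_time_eq _ _ _ _ _ _ (Ordinal (sN : (size s < N.+1)%N)) (st j).
have := natural_filtration_saturated Ftau (w := w) (w' := w').
case=> [k /= ks|/(_ tw) /= -> _]; last by rewrite /= eqxx.
by rewrite !(price_cylinder_take _ ks).
Qed.

Lemma control_ofE tau s w : admissible S m N tau -> (size s <= N)%N ->
  cyl s w -> control_of tau s = exercised_at (fun j => tau j w) (size s).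
Proof.
move=> adm sN cw; apply/asboolP/idP => [[w' cw']|ex]; last by exists w.
exact: exercised_at_cylinder.
Qed.

Lemma swing_payoff_control tau s w : admissible S m N tau -> size s = N ->
  cyl s w ->
  swing_payoff r K S tau w = control_payoff r lam K (control_of tau) S0 s.
Proof.
move=> adm sN cw; have [_ /(_ w) pat] := adm.
rewrite /swing_payoff (big_exercised (fun k => discount r ^+ k * put K (S k w)) pat).
rewrite /control_payoff sN; apply: eq_bigr => k _.
have ks : (k <= size s)%N by rewrite [leqRHS]sN leq_ord.
have sk : size (take k s) = k by rewrite size_takel.
rewrite (control_ofE adm _ (cylinder_take (k := k) cw)) sk; last exact: leq_ord.
by rewrite (price_cylinder_take cw ks).
Qed.

Let p_gt0 := up_prob_gt0 no_arbitrage.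
Let p_lt1 := up_prob_lt1 no_arbitrage.

Lemma exercise_count_control tau s : admissible S m N tau -> size s = N ->
  (exercise_count (control_of tau) s <= m)%N.
Proof.
move=> adm sN; have [w cw] : cyl s !=set0.
  by apply: (cylinder_nonempty p_gt0 p_lt1 eps_indep eps_up eps_down); rewrite sN.
have [_ /(_ w) pat] := adm.
rewrite /exercise_count sN.
rewrite (eq_bigr (fun k : 'I_N.+1 =>
    if exercised_at (fun j => tau j w) k then 1%N else 0%N)); last first.
  move=> k _; have ks : (k <= size s)%N by rewrite [leqRHS]sN leq_ord.
  have sk : size (take k s) = k by rewrite size_takel.
  rewrite (control_ofE adm _ (cylinder_take (k := k) cw)) sk; last exact: leq_ord.
  by case: ifP.
rewrite -(big_exercised (fun=> 1%N) pat).
rewrite -[leqRHS](card_ord m) -sum1_card; apply: leq_sum => j _.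
by case: (tau j w).
Qed.

Lemma measurable_swing_payoff tau : admissible S m N tau ->
  measurable_fun setT (swing_payoff r K S tau).
Proof.
move=> [st _]; apply: measurable_sum => j.
(* Decomposing over the value of the stopping time replaces the price at a random date by measurable
   prices at fixed dates. *)
rewrite (_ : (fun w => _) = fun w => \sum_(k < N.+1)
    (\1_[set w | tau j w = Some k] w * (discount r ^+ k * put K (S k w)))).
  apply: measurable_sum => k; apply: measurable_funM.
    apply: measurable_indic; apply: (natural_filtration_measurable measurable_price).
    exact: stopping_time_eq.
  apply: measurable_funM; first exact: measurable_cst.
  apply: measurable_maxr; last exact: measurable_cst.
  by apply: measurable_funB; [exact: measurable_cst|exact: measurable_price].
apply/funext => w; case tj : (tau j w) => [nu|].
  rewrite (bigD1 nu)//= indicE mem_set// mul1r big1 ?addr0// => k knu.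
  rewrite indicE memNset ?mul0r//= tj => -[nuk]; by rewrite nuk eqxx in knu.
by rewrite big1// => k _; rewrite indicE memNset ?mul0r//= tj.
Qed.

Lemma expectation_swing_payoff tau : admissible S m N tau ->
  'E_P[swing_payoff r K S tau]%E
  = (control_value r lam K N (control_of tau) S0)%:E.
Proof.
move=> adm; rewrite -path_mean_control_payoff.
apply: (expectation_path_mean p_gt0 p_lt1 eps_indep eps_up eps_down).
- exact: measurable_swing_payoff.
- move=> w; apply: sumr_ge0 => j _; case: (tau j w) => // nu.
  by rewrite mulr_ge0 ?put_ge0// exprn_ge0// ltW// discount_gt0.
- by move=> s w sN cw; rewrite (swing_payoff_control adm sN cw).
Qed.

Lemma expectation_le_swing_value tau : admissible S m N tau ->
  ('E_P[swing_payoff r K S tau] <= (swing_value r lam K m N S0)%:E)%E.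
Proof.
move=> adm; rewrite expectation_swing_payoff// lee_fin.
apply: control_value_le_swing_value => // s sN.
exact: exercise_count_control.
Qed.

Local Notation D := (exercise_region r lam K).
Local Notation sigma := (threshold_policy r lam K S m N).

Lemma threshold_policy_pattern w : exercise_pattern (fun j => sigma j w).
Proof.
exact: (@successive_pattern N
  (fun j nu => S nu w \in D (m - j) (N - nu)) (fun j => threshold_time r lam K S m N j w)).
Qed.

Lemma measurable_exercise_region i n : measurable (D i.+1 n).
Proof.
rewrite (exercise_regionE r_gt0 lam_gt1 no_arbitrage K_gt0).
rewrite (_ : [set x | _] = `]0, exercise_boundary r lam K i.+1 n]%classic).
  exact: measurable_itv.
by apply/seteqP; split=> x /=; rewrite in_itv.
Qed.

Lemma threshold_time_stopping j : (j < m)%N ->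
  stopping_time S (threshold_time r lam K S m N j).
Proof.
(* The bound on [i] keeps the number of rights positive, where the region is known to be an
   interval. *)
have mD i (k : 'I_N.+1) : (i < m)%N ->
    natural_filtration S k [set w | S k w \in D (m - i) (N - k)].
  move=> im; rewrite (_ : [set w | _] = S k @^-1` D (m - i) (N - k)).
    apply: natural_filtration_preimage => //.
    have -> : (m - i = (m - i).-1.+1)%N by lia.
    exact: measurable_exercise_region.
  by apply/seteqP; split=> w /=; [exact: set_mem|exact: mem_set].
elim: j => [|j IHj] jm /=.
  by apply: (@stopping_time_first_time _ _ _ _ N
    (fun k w => S k w \in D m (N - k))) => k; rewrite -[m in D m]subn0; exact: mD.
apply: (@stopping_time_first_time _ _ _ _ N (fun k w =>
   strictly_after (threshold_time r lam K S m N j w) k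
   && (S k w \in D (m - j.+1) (N - k)))) => k.
rewrite (_ : [set w | _] =
  [set w | strictly_after (threshold_time r lam K S m N j w) k] `&`
  [set w | S k w \in D (m - j.+1) (N - k)]).
  apply: natural_filtrationI; last exact: mD.
  by apply: strictly_after_filtration; apply: IHj; exact: ltnW.
by apply/seteqP; split=> w /=; [move=> /andP[]|move=> [-> ->]].
Qed.

Lemma threshold_policy_admissible : admissible S m N sigma.
Proof.
split=> [j|w]; last exact: threshold_policy_pattern.
exact: threshold_time_stopping.
Qed.

(** On an outcome through [s], [exercised_atE] describes exercise by counting earlier exercises;
    [control_ofE] transports both the decision and the count to the tree. *)
Lemma threshold_policy_control :
  is_threshold_control r lam K N m (control_of sigma) S0.
Proof.
have adm := threshold_policy_admissible.
move=> s sN; have [w cw] : cyl s !=set0.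
  exact: (cylinder_nonempty p_gt0 p_lt1 eps_indep eps_up eps_down).
rewrite /= (control_ofE adm sN cw).
rewrite (eq_bigr (fun k : 'I_(size s) =>
    nat_of_bool (exercised_at (fun j => sigma j w) k))); last first.
  move=> k _; have ks := ltnW (ltn_ord k).
  have sk : size (take k s) = k by rewrite size_takel.
  by rewrite (control_ofE adm _ (cylinder_take (k := k) cw)) sk// (leq_trans ks).
rewrite -(price_cylinder cw).
have := @exercised_atE N (fun j nu => S nu w \in D (m - j) (N - nu))
  (fun j => threshold_time r lam K S m N j w) _ (fun=> erefl) m
  (Ordinal (sN : (size s < N.+1)%N)).
by rewrite /= subn0; apply.
Qed.

Lemma expectation_threshold_policy :
  'E_P[swing_payoff r K S sigma]%E = (swing_value r lam K m N S0)%:E.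
Proof.
rewrite expectation_swing_payoff; last exact: threshold_policy_admissible.
congr _%:E; apply: control_value_threshold => //.
exact: threshold_policy_control.
Qed.

End exercise_policies.

Theorem theorem3p8 (R : realType) (r lam K S0 : R) (N m : nat)
  (d : measure_display) (Omega : measurableType d) (P : probability Omega R)
  (eps : nat -> {RV P >-> R})
  (r_gt0 : 0 < r) (lam_gt1 : 1 < lam) (no_arbitrage : lam^-1 < 1 + r < lam)
  (K_gt0 : 0 < K) (S0_gt0 : 0 < S0) (m_gt0 : (1 <= m)%N)
  (eps_indep : mutually_independent P [set k | (1 <= k <= N)%N]
                 (fun k => eps k : Omega -> R))
  (eps_up : forall k, (1 <= k <= N)%N ->
     P (eps k @^-1` [set 1]) = (up_prob r lam)%:E)
  (eps_down : forall k, (1 <= k <= N)%N ->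
     P (eps k @^-1` [set -1]) = (1 - up_prob r lam)%:E) :
  let g := put K in
  let A := one_step r lam in
  let V := swing_value r lam K in
  let f := continuation r lam K in
  let xstar := exercise_boundary r lam K in
  let D := exercise_region r lam K in
  let S := price S0 lam (fun k => eps k : Omega -> R) in
  let sigma := threshold_policy r lam K S m N in
  (* (i) *)
  [/\ (forall n : nat,
         [/\ (forall x y : R, 0 < x -> x <= y -> y <= K ->
                g y - f m n y <= g x - f m n x),
             (\forall x \near 0^'+, 0 < g x - f m n x),
             g K - f m n K <= 0,
             0 < xstar m n <= K
           & D m n = [set x | 0 < x <= xstar m n]])
      /\ (forall (n : nat) (x : R), D m n.+1 x ->
            V m n.+1 x = g x + A (V m.-1 n) x)
      /\ (forall (n : nat) (x : R), K < x ->
            V m n.+1 x = A (V m n) x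
            /\ (V m n.+1 x = g x + A (V m.-1 n) x <->
                g x = 0 /\ f m n.+1 x = 0)),
  (* (ii) *)
      [/\ 0 < xstar m N,
          (forall n : nat, (n < N)%N -> xstar m n.+1 <= xstar m n),
          xstar m 0%N = K
        & (forall n : nat, (n <= m.-1)%N -> xstar m n = K)],
  (* (iii) *)
      (forall n i : nat, (1 <= i < m)%N ->
         xstar i n <= xstar i.+1 n /\ D i n `<=` D i.+1 n)
  (* (iv) *)
    & [/\ (forall w : Omega, exercise_pattern (fun j => sigma j w)),
          admissible S m N sigma,
          (V m N S0)%:E = ('E_P[swing_payoff r K S sigma])%E
        & ('E_P[swing_payoff r K S sigma])%E
          = ereal_sup [set ('E_P[swing_payoff r K S tau])%E
                      | tau in admissible S m N]]].
Proof.
move=> /=; case: m m_gt0 => // i _; split.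
- split; last split.
  + move=> n; split.
    * by move=> x y x0 xy yK; apply: exercise_gain_nonincreasing.
    * have aK : 0 < (1 - discount r) * K.
        by rewrite mulr_gt0// subr_gt0 discount_lt1.
      near=> x; apply: (exercise_gain_gt0 r_gt0 lam_gt1 no_arbitrage K_gt0).
        by near: x; exact: nbhs_right_gt.
      by near: x; exact: nbhs_right_lt.
    * rewrite put_ge_strike// sub0r oppr_le0.
      exact: continuation_ge0.
    * rewrite exercise_boundary_gt0//=.
      exact: (exercise_boundary_le_strike r_gt0 lam_gt1 no_arbitrage K_gt0).
    * exact: exercise_regionE.
  + by move=> n x; exact: (@swing_value_exercise _ r lam K i n x).
  + by move=> n x; exact: swing_value_above_strike.
- split.
  + exact: exercise_boundary_gt0.
  + move=> n _; apply: exercise_boundary_le => //.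
    exact: exercise_region_horizon.
  + exact: exercise_boundary_eq_strike.
  + by move=> n; exact: exercise_boundary_eq_strike.
- move=> n [//|j] _.
  have sub := @exercise_region_rights _ r lam K r_gt0 lam_gt1 no_arbitrage j n.
  by split=> //; apply: exercise_boundary_le.
- have adm := threshold_policy_admissible i.+1 N eps
    r_gt0 lam_gt1 no_arbitrage K_gt0 S0_gt0.
  have E := @expectation_threshold_policy _ r lam K S0 i.+1 N _ _ P eps
    r_gt0 lam_gt1 no_arbitrage K_gt0 S0_gt0 eps_indep eps_up eps_down.
  split=> //; first exact: threshold_policy_pattern.
  (* The threshold policy competes in the supremum, and its expectation equals the bound valid for
     every admissible policy. *)
  apply/eqP; rewrite eq_le; apply/andP; split.
    by apply: ereal_sup_ubound; eexists; first exact: adm.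
  apply: ge_ereal_sup => _ [tau tauA <-]; rewrite E.
  exact: expectation_le_swing_value.
Unshelve. all: by end_near.
Qed.
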